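(* Let $c\in\mathbf R$, $c\neq0$. Let $M=T_1\mathbf E^{n+1}=\mathbf E^{n+1}\times S^n\subset\mathbf E^{n+1}\times\mathbf E^{n+1}$ with coordinates $(x;y)=(x_1,\dots,x_{n+1};y_1,\dots,y_{n+1})$, $|y|=1$, and let $\theta=\sum_{i=1}^{n+1}y_idx_i$ restricted to $M$, $D=\{\theta=0\}$, $$E_1=\Big\{\sum_i\xi_i\frac{\partial}{\partial x_i}\ \Big|\ \sum_i\xi_iy_i=0\Big\},\qquad E_2=\Big\{\sum_i\eta_i\frac{\partial}{\partial y_i}\ \Big|\ \text{tangent to }S^n\Big\},$$ $$\omega=c\sum_{i=1}^{n+1}(-1)^{i+1}y_i\,dx_1\wedge\cdots\wedge\breve{dx_i}\wedge\cdots\wedge dx_{n+1}-\sum_{i=1}^{n+1}(-1)^{i+1}y_i\,dy_1\wedge\cdots\wedge\breve{dy_i}\wedge\cdots\wedge dy_{n+1}$$ restricted to $M$. Then the system $\mathcal M$ generated by $(\theta,d\theta,\omega)$ is a Monge--Ampère system with the Lagrangian pair $(E_1,E_2)$ on $M$. The Gaussian curvature of the projection to $W_1=\mathbf E^{n+1}$, $(x,y)\mapsto x$, of a geometric solution of $\mathcal M$ is equal to the constant $c$ outside of the singular locus.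
   Context: $\mathbf E^{n+1}$ is Euclidean space; $\breve{\ }$ means that the factor is omitted. A Lagrangian pair on a contact manifold $(M^{2n+1},D=\{\theta=0\})$ is a pair $(E_1,E_2)$ of rank-$n$ subbundles of $D$, isotropic for $d\theta$, with $D=E_1\oplus E_2$. A (bi-decomposable) Monge--Ampère system with Lagrangian pair $(E_1,E_2)$ is an ideal $\langle\theta,d\theta,\omega\rangle$ of differential forms, where (locally) $\omega=\omega_1-\omega_2$ with $n$-forms such that $i_u\omega_1=0$ for $u\in E_2$, $i_v\omega_2=0$ for $v\in E_1$, $\omega_1|_{E_1}$ is a volume form on $E_1$ and $\omega_2|_{E_2}$ is a volume form on $E_2$. A geometric solution of $\mathcal M$ is an immersion $g:L\to M$ of an $n$-dimensional manifold $L$ with $g^*\theta=0$ and $g^*\omega=0$. The singular locus of its projection is the set of points where the composition of $g$ with $(x,y)\mapsto x$ is not an immersion; outside it, the composition is an immersed hypersurface with unit normal $y$. The Gaussian (Gauss--Kronecker) curvature $K$ is the (signed) ratio of volumes in the Gauss map given by the unit normal $y$, i.e. the determinant of the differential of the Gauss map, where the tangent space of the hypersurface at $x$ is identified with $T_yS^n=y^\perp$. *)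

(* Defs.v *)
From HB Require Import structures.
From mathcomp Require Import all_boot all_order all_algebra all_fingroup.
From mathcomp Require Import all_classical all_reals all_analysis.

Set Implicit Arguments.
Unset Strict Implicit.
Unset Printing Implicit Defensive.

Import Order.TTheory GRing.Theory Num.Theory.
Import numFieldNormedType.Exports.

Local Open Scope classical_set_scope.
Local Open Scope ring_scope.

(* [Ck k U f] : [f] is of class C^k on the open set [U].  The spaces used below
   are finite-dimensional, so that C^{k+1} amounts to being differentiable with
   every directional derivative of class C^k. *)
Fixpoint Ck (R : realType) (V W : normedModType R) (k : nat) (U : set V)
    (f : V -> W) : Prop :=
  if k is k'.+1 then
    (forall p, U p -> differentiable f p) /\
    (forall v, Ck k' U (fun p => 'D_v f p))
  else forall p, U p -> {for p, continuous f}.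

Definition smooth_on (R : realType) (V W : normedModType R) (U : set V)
  (f : V -> W) : Prop := forall k, Ck k U f.

Notation euclid R n := ('rV[R]_n.+1) (only parsing).
Notation ambient R n := ('rV[R]_n.+1 * 'rV[R]_n.+1)%type.

(* The library norm on row vectors is the sup norm; lengths and orthogonality
   below refer to this inner product. *)
Definition dot (R : realType) (m : nat) (u v : 'rV[R]_m) : R :=
  \sum_i u ord0 i * v ord0 i.

Definition sphere (R : realType) (n : nat) : set (euclid R n) :=
  [set y | dot y y = 1].

Definition unit_tangent_bundle (R : realType) (n : nat) : set (ambient R n) :=
  [set p | sphere p.2].

(* Velocities at [p] of curves drawn on [S]; for an embedded submanifold this is
   the tangent space, seen inside the ambient space. *)
Definition tangent (R : realType) (V : normedModType R) (S : set V) (p : V) :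
    set V :=
  [set v | exists gamma : R -> V,
    [/\ gamma 0 = p, \forall t \near (0 : R), S (gamma t)
      & is_derive (0 : R) 1 gamma v]].

Definition submanifold (R : realType) (n d : nat) (M : set (ambient R n)) :
    Prop :=
  forall p, M p -> exists (U : set (ambient R n)) (m : nat)
      (F : ambient R n -> 'rV[R]_m),
    [/\ open_nbhs p U,
        (d + m)%N = \dim (fullv : {vspace ambient R n}),
        smooth_on U F,
        forall q, U q -> (M q <-> F q = 0)
      & forall q, U q -> M q -> forall w, exists v, 'd F q v = w].

(* Smooth subbundle of rank [r], over [M], of the trivial bundle with fibre the
   ambient space: it has smooth local frames. *)
Definition subbundle (R : realType) (n r : nat) (M : set (ambient R n))
    (E : ambient R n -> set (ambient R n)) : Prop :=
  forall p, M p -> exists (U : set (ambient R n))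
      (X : 'I_r -> ambient R n -> ambient R n),
    [/\ open_nbhs p U,
        forall i, smooth_on U (X i)
      & forall q, M q -> U q ->
          free [tuple X i q | i < r] /\ E q = [set` <<[tuple X i q | i < r]>>%VS]].

(* A differential form on an open piece [M `&` U] of a submanifold [M] is given
   by an ambient form on [U]; two of them are the same form on [M `&` U] when
   they agree on tangent vectors of [M] ([eq_form]). *)

Definition form (R : realType) (n k : nat) : Type :=
  ambient R n -> ('I_k -> ambient R n) -> R.

Definition is_form (R : realType) (n : nat) (U : set (ambient R n)) (k : nat)
    (eta : form R n k) : Prop :=
  [/\ forall p, U p -> forall (v : 'I_k -> ambient R n) i (a : R) u w,
        eta p (dfwith v i (a *: u + w)) =
        a * eta p (dfwith v i u) + eta p (dfwith v i w),
      forall p, U p -> forall (v : 'I_k -> ambient R n) i j,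
        i != j -> v i = v j -> eta p v = 0
    & forall v, smooth_on U (fun p => eta p v : R)].

Definition eq_form (R : realType) (n : nat) (M U : set (ambient R n)) (k : nat)
    (eta eta' : form R n k) : Prop :=
  forall p, M p -> U p -> forall v : 'I_k -> ambient R n,
    (forall i, tangent M p (v i)) -> eta p v = eta' p v.

Definition wedge (R : realType) (n k l : nat) (alpha : form R n k)
    (beta : form R n l) : form R n (k + l) :=
  fun p v => (k`!%:R * l`!%:R)^-1 *
    \sum_(s : 'S_(k + l)) (-1) ^+ s *
      alpha p (fun i => v (s (lshift l i))) *
      beta p (fun j => v (s (rshift k j))).

(* alpha_0 /\ ... /\ alpha_{k-1}; note that (1 + k)%N is convertible to k.+1. *)
Fixpoint bigwedge (R : realType) (n k : nat) :
    ('I_k -> form R n 1) -> form R n k :=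
  if k is k'.+1 then
    fun a => wedge (a ord0) (bigwedge (fun i : 'I_k' => a (lift ord0 i)))
  else fun _ _ _ => 1.

(* Exterior derivative; vector arguments are extended to constant fields. *)
Definition extd (R : realType) (n k : nat) (eta : form R n k) :
    form R n k.+1 :=
  fun p v => \sum_(i < k.+1) (-1) ^+ i *
    'D_(v i) (fun q => eta q (fun j => v (lift i j)) : R) p.

Definition dx (R : realType) (n : nat) (i : 'I_n.+1) : form R n 1 :=
  fun _ v => (v ord0).1 ord0 i.

Definition dy (R : realType) (n : nat) (i : 'I_n.+1) : form R n 1 :=
  fun _ v => (v ord0).2 ord0 i.

(* The ideal, in the algebra of differential forms on [M `&` U], generated by
   the family [G] of homogeneous forms: [ideal M U G k] is its degree-[k]
   part. *)
Inductive ideal (R : realType) (n : nat) (M U : set (ambient R n))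
    (G : forall k, set (form R n k)) : forall k, form R n k -> Prop :=
| ideal_gen k eta : G k eta -> ideal M U G eta
| ideal_zero k : ideal M U G (fun _ _ => 0 : R) (k := k)
| ideal_add k (eta eta' : form R n k) :
    ideal M U G eta -> ideal M U G eta' ->
    ideal M U G (fun p v => eta p v + eta' p v)
| ideal_wedgel k l (alpha : form R n k) (eta : form R n l) :
    is_form U alpha -> ideal M U G eta -> ideal M U G (wedge alpha eta)
| ideal_wedger k l (eta : form R n k) (alpha : form R n l) :
    is_form U alpha -> ideal M U G eta -> ideal M U G (wedge eta alpha)
| ideal_eq k (eta eta' : form R n k) :
    is_form U eta' -> eq_form M U eta eta' ->
    ideal M U G eta -> ideal M U G eta'.

Inductive generators (R : realType) (n m : nat) (theta : form R n 1)
    (omega : form R n m) : forall k, form R n k -> Prop :=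
| gen_theta : generators theta omega theta
| gen_dtheta : generators theta omega (extd theta)
| gen_omega : generators theta omega omega.

Definition kernel_dist (R : realType) (n : nat) (M : set (ambient R n))
    (theta : form R n 1) (p : ambient R n) : set (ambient R n) :=
  [set v | tangent M p v /\ theta p (tnth [tuple v]) = 0].

Definition contact_manifold (R : realType) (n : nat) (M : set (ambient R n))
    (theta : form R n 1) : Prop :=
  [/\ submanifold n.*2.+1 M, is_form setT theta
    & forall p, M p ->
        (exists2 v, tangent M p v & theta p (tnth [tuple v]) != 0) /\
        (forall u, kernel_dist M theta p u ->
           (forall v, kernel_dist M theta p v ->
              extd theta p (tnth [tuple u; v]) = 0) -> u = 0)].

Definition isotropic (R : realType) (n : nat) (M : set (ambient R n))
    (theta : form R n 1) (E : ambient R n -> set (ambient R n)) : Prop :=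
  forall p, M p -> forall u v, E p u -> E p v ->
    extd theta p (tnth [tuple u; v]) = 0.

Definition lagrangian_pair (R : realType) (n : nat) (M : set (ambient R n))
    (theta : form R n 1) (E1 E2 : ambient R n -> set (ambient R n)) : Prop :=
  [/\ subbundle n M E1 /\ subbundle n M E2,
      isotropic M theta E1 /\ isotropic M theta E2
    & forall p, M p ->
        (kernel_dist M theta p =
           [set v | exists u1 u2, [/\ E1 p u1, E2 p u2 & v = u1 + u2]]) /\
        E1 p `&` E2 p = [set 0]].

(* [i_u omega = 0 for u in E], on [M `&` U].  As [omega] is alternating, the
   vector of [E] may be in any position. *)
Definition contracts_to_zero (R : realType) (n k : nat)
    (M U : set (ambient R n)) (E : ambient R n -> set (ambient R n))
    (omega : form R n k) : Prop :=
  forall p, M p -> U p -> forall v : 'I_k -> ambient R n,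
    (forall i, tangent M p (v i)) -> forall j, E p (v j) -> omega p v = 0.

(* The restriction to the rank-[k] bundle [E] of the [k]-form [omega] is a
   volume form: it vanishes nowhere. *)
Definition volume_form_on (R : realType) (n k : nat)
    (M U : set (ambient R n)) (E : ambient R n -> set (ambient R n))
    (omega : form R n k) : Prop :=
  forall p, M p -> U p -> exists2 v : 'I_k -> ambient R n,
    (forall i, E p (v i)) & omega p v != 0.

(* The family [I] is an ideal of forms on the contact manifold [M] which, near
   every point, coincides with <theta, d theta, omega1 - omega2>; the ideal that
   [I] induces on [M `&` U] is [ideal M U I]. *)
Definition monge_ampere_system (R : realType) (n : nat)
    (M : set (ambient R n)) (theta : form R n 1)
    (E1 E2 : ambient R n -> set (ambient R n))
    (I : forall k, set (form R n k)) : Prop :=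
  [/\ contact_manifold M theta,
      lagrangian_pair M theta E1 E2,
      forall k (eta : form R n k), ideal M setT I eta -> I k eta
    & forall p, M p -> exists U (omega1 omega2 : form R n n),
        [/\ open_nbhs p U,
            is_form U omega1 /\ is_form U omega2,
            contracts_to_zero M U E2 omega1 /\ contracts_to_zero M U E1 omega2,
            volume_form_on M U E1 omega1 /\ volume_form_on M U E2 omega2
          & forall k (eta : form R n k), ideal M U I eta <->
              ideal M U
                (generators theta (fun q v => omega1 q v - omega2 q v)) eta]].

Record chart (R : realType) (m : nat) (L : topologicalType) := Chart {
  chart_dom : set L;
  chart_map : L -> 'rV[R]_m;
  chart_inv : 'rV[R]_m -> L }.

Definition is_chart (R : realType) (m : nat) (L : topologicalType)
    (phi : chart R m L) : Prop :=
  [/\ open (chart_dom phi), open (chart_map phi @` chart_dom phi),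
      forall p, chart_dom phi p -> chart_inv phi (chart_map phi p) = p,
      {within chart_dom phi, continuous (chart_map phi)}
    & {within chart_map phi @` chart_dom phi, continuous (chart_inv phi)}].

Record manifold (R : realType) (m : nat) := Manifold {
  carrier :> topologicalType;
  atlas : set (chart R m carrier);
  manifold_hausdorff : hausdorff_space carrier;
  manifold_second_countable : @second_countable carrier;
  atlas_charts : forall phi, atlas phi -> is_chart phi;
  atlas_cover : forall p, exists2 phi, atlas phi & chart_dom phi p;
  atlas_smooth : forall phi psi, atlas phi -> atlas psi ->
    smooth_on (chart_map phi @` (chart_dom phi `&` chart_dom psi))
      (chart_map psi \o chart_inv phi) }.

Arguments atlas {R m} _ _.

Definition chart_at (R : realType) (m : nat) (L : manifold R m) (p : L)
    (phi : chart R m L) : Prop := atlas L phi /\ chart_dom phi p.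

Definition smooth_map (R : realType) (m : nat) (L : manifold R m)
    (W : normedModType R) (f : L -> W) : Prop :=
  forall phi, atlas L phi ->
    smooth_on (chart_map phi @` chart_dom phi) (f \o chart_inv phi).

(* The differential of [f] at [p], T_pL being identified with R^m by [phi]. *)
Definition mdiff (R : realType) (m : nat) (L : manifold R m)
    (W : normedModType R) (f : L -> W) (p : L) (phi : chart R m L) :
    'rV[R]_m -> W :=
  'd (f \o chart_inv phi) (chart_map phi p).

Definition immersive_at (R : realType) (m : nat) (L : manifold R m)
    (W : normedModType R) (f : L -> W) (p : L) : Prop :=
  forall phi, chart_at p phi -> injective (mdiff f p phi).

Definition pullback_zero (R : realType) (n m k : nat) (L : manifold R m)
    (g : L -> ambient R n) (eta : form R n k) : Prop :=
  forall p phi, chart_at p phi -> forall w : 'I_k -> 'rV[R]_m,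
    eta (g p) (fun i => mdiff g p phi (w i)) = 0.

Definition geometric_solution (R : realType) (n : nat) (M : set (ambient R n))
    (theta : form R n 1) (omega : form R n n) (L : manifold R n)
    (g : L -> ambient R n) : Prop :=
  [/\ forall p, M (g p), smooth_map g, forall p, immersive_at g p,
      pullback_zero g theta & pullback_zero g omega].

Definition proj_x (R : realType) (n : nat) (p : ambient R n) : euclid R n :=
  p.1.

Definition proj_y (R : realType) (n : nat) (p : ambient R n) : euclid R n :=
  p.2.

Definition singular_locus (R : realType) (n : nat) (L : manifold R n)
    (g : L -> ambient R n) : set L :=
  [set p | ~ immersive_at (@proj_x R n \o g) p].

Definition lfun_det (K : fieldType) (vT : vectType K) (A : 'End(vT)) : K :=
  \det (passmx.mxof (vbasis {:vT}) (vbasis {:vT}) A).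

Definition perp (R : realType) (n : nat) (y : euclid R n) :
    {vspace euclid R n} :=
  lker (linfun (fun xi : euclid R n => dot xi y : R^o)).

(* For a hypersurface [f] with unit normal [nu], the differential at [p] of the
   Gauss map, as an endomorphism of [perp (nu p)]: it sends df(w) to dnu(w).
   [(f^-1)%VF] is the inverse on the image of an injective linear map [f]. *)
Definition gauss_map_diff (R : realType) (n : nat) (L : manifold R n)
    (f nu : L -> euclid R n) (p : L) (phi : chart R n L) :
    'End(subvs_of (perp (nu p))) :=
  (linfun (vsproj (perp (nu p))) \o linfun (mdiff nu p phi) \o
    (linfun (mdiff f p phi))^-1 \o linfun vsval)%VF.

(* At [p], [f] is an immersed hypersurface with unit normal [nu], and its
   Gaussian curvature with respect to this normal is [K]. *)
Definition has_gaussian_curvature (R : realType) (n : nat) (L : manifold R n)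
    (f nu : L -> euclid R n) (p : L) (K : R) : Prop :=
  forall phi, chart_at p phi ->
    [/\ injective (mdiff f p phi),
        sphere (nu p),
        forall w, dot (mdiff f p phi w) (nu p) = 0
      & lfun_det (gauss_map_diff f nu p phi) = K].

Definition theta_std (R : realType) (n : nat) : form R n 1 :=
  fun p v => \sum_i p.2 ord0 i * dx i p v.

Definition E1_std (R : realType) (n : nat) (p : ambient R n) :
    set (ambient R n) :=
  [set v | dot v.1 p.2 = 0 /\ v.2 = 0].

Definition E2_std (R : realType) (n : nat) (p : ambient R n) :
    set (ambient R n) :=
  [set v | v.1 = 0 /\ tangent (@sphere R n) p.2 v.2].

(* Indices start from 0, whence (-1)^i for the usual (-1)^(i+1); [lift i]
   enumerates the indices other than [i] increasingly. *)
Definition omega_std (R : realType) (n : nat) (c : R) : form R n n :=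
  fun p v =>
    c * (\sum_(i < n.+1) (-1) ^+ i * p.2 ord0 i *
          bigwedge (fun j : 'I_n => @dx R n (lift i j)) p v) -
    \sum_(i < n.+1) (-1) ^+ i * p.2 ord0 i *
          bigwedge (fun j : 'I_n => @dy R n (lift i j)) p v.

(* Main.v *)
(* Let det(y, w_1, ..., w_n) be the volume form of the hyperplane orthogonal to
   the unit vector y.  Expanding along the first row, omega at (x, y) sends
   (u_i, v_i)_i to c det(y, u_1, ..., u_n) - det(y, v_1, ..., v_n), while d theta
   pairs (u, v) and (u', v') to <v, u'> - <v', u>.  The two terms of omega are
   thus volume forms on E_1 and E_2, each killed by the other bundle.

   On a geometric solution, theta = 0 says that y is normal to the projection
   x, and omega = 0 says that det(y, dy w_1, ..., dy w_n) =
   c det(y, dx w_1, ..., dx w_n).  Where dx is injective, this means that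
   dy (dx)^-1 multiplies the volume of the hyperplane orthogonal to y by c, so
   its determinant is c. *)

Require Import Defs.
From HB Require Import structures.
From mathcomp Require Import all_boot all_order all_algebra all_fingroup.
From mathcomp Require Import all_classical all_reals all_analysis.
From mathcomp Require Import ring zify.

Set Implicit Arguments.
Unset Strict Implicit.
Unset Printing Implicit Defensive.

Import Order.TTheory GRing.Theory Num.Theory.
Import numFieldNormedType.Exports.

Local Open Scope classical_set_scope.
Local Open Scope ring_scope.

(** * Determinants and wedge products of 1-forms *)

Section Algebra.
Context (R : realType).

Lemma dotC m (u v : 'rV[R]_m) : dot u v = dot v u.
Proof. by apply: eq_bigr => i _; rewrite mulrC. Qed.

Lemma dot_linearl m (a : R) (u v w : 'rV[R]_m) :
  dot (a *: u + v) w = a * dot u w + dot v w.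
Proof.
rewrite /dot mulr_sumr -big_split; apply: eq_bigr => i _ /=.
by rewrite !mxE mulrDl mulrA.
Qed.

Lemma dot0l m (w : 'rV[R]_m) : dot 0 w = 0.
Proof. by rewrite /dot big1// => i _; rewrite mxE mul0r. Qed.

Lemma dotDl m (u v w : 'rV[R]_m) : dot (u + v) w = dot u w + dot v w.
Proof. by rewrite -[u]scale1r dot_linearl mul1r scale1r. Qed.

Lemma dotZl m (a : R) (u w : 'rV[R]_m) : dot (a *: u) w = a * dot u w.
Proof. by rewrite -[a *: u]addr0 dot_linearl dot0l addr0. Qed.

Lemma dotDr m (u v w : 'rV[R]_m) : dot w (u + v) = dot w u + dot w v.
Proof. by rewrite !(dotC w) dotDl. Qed.

Lemma dotZr m (a : R) (u w : 'rV[R]_m) : dot w (a *: u) = a * dot w u.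
Proof. by rewrite !(dotC w) dotZl. Qed.

Lemma dotNl m (u w : 'rV[R]_m) : dot (- u) w = - dot u w.
Proof. by rewrite -scaleN1r dotZl mulN1r. Qed.

Lemma dot0r m (w : 'rV[R]_m) : dot w 0 = 0.
Proof. by rewrite dotC dot0l. Qed.

Lemma dotxx_ge0 m (u : 'rV[R]_m) : 0 <= dot u u.
Proof. by apply: sumr_ge0 => i _; rewrite -expr2 sqr_ge0. Qed.

Lemma dotxx_eq0 m (u : 'rV[R]_m) : dot u u = 0 -> u = 0.
Proof.
move=> /eqP; rewrite psumr_eq0; last by move=> i _; rewrite -expr2 sqr_ge0.
move=> /allP u0; apply/rowP => i; rewrite mxE.
by have := u0 i; rewrite mem_index_enum => /(_ isT); rewrite mulf_eq0 orbb => /eqP.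
Qed.

(* The value on [w] of the volume form of the hyperplane orthogonal to [y], when
   [y] is a unit vector and the [w i] lie in that hyperplane. *)
Definition voldet n (y : 'rV[R]_n.+1) (w : 'I_n -> 'rV[R]_n.+1) : R :=
  \det (col_mx y (\matrix_i w i) : 'M[R]_(1 + n)).

Lemma col_mx_row0 n (y : 'rV[R]_n.+1) (w : 'I_n -> 'rV[R]_n.+1) j :
  (col_mx y (\matrix_i w i) : 'M[R]_(1 + n)) ord0 j = y ord0 j.
Proof.
by have -> : ord0 = lshift n ord0 :> 'I_(1 + n); [exact: val_inj|rewrite col_mxEu].
Qed.

Lemma col_mx_rowS n (y : 'rV[R]_n.+1) (w : 'I_n -> 'rV[R]_n.+1) (i : 'I_n) j :
  (col_mx y (\matrix_i w i) : 'M[R]_(1 + n)) (lift ord0 i) j = w i ord0 j.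
Proof.
have -> : lift ord0 i = rshift 1 i :> 'I_(1 + n) by exact: val_inj.
by rewrite col_mxEd mxE.
Qed.

(** Laplace expansion along the row [y]. The minors are transposed so that rows index coordinates
    and columns index vectors, as in [bigwedgeE]. *)
Lemma voldet_expand n (y : 'rV[R]_n.+1) (w : 'I_n -> 'rV[R]_n.+1) :
  voldet y w = \sum_(i < n.+1) (-1) ^+ i * y ord0 i *
    \det (\matrix_(j, k) w k ord0 (lift i j)).
Proof.
rewrite /voldet (expand_det_row _ ord0); apply: eq_bigr => i _.
rewrite col_mx_row0 /cofactor add0n mulrCA mulrA; congr (_ * _).
rewrite -det_tr; congr (\det _); apply/matrixP => j k.
by rewrite [LHS]mxE [LHS]mxE [LHS]mxE col_mx_rowS mxE.
Qed.

(** The normalisation [(k! l!)^-1] of [wedge] is the one for which a product of 1-forms is a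
    determinant with no extra factor. This turns the two sums of [omega_std] into values of
    [voldet]. *)
Lemma bigwedgeE n k (a : 'I_k -> Defs.form R n 1) p v :
  bigwedge a p v = \det (\matrix_(i, j) a i p (fun=> v j)).
Proof.
elim: k a v => [|k IH] a v /=; first by rewrite det_mx00.
rewrite /wedge.
(* For a fixed permutation [t] of the last factor, the change of variable
   s := (0, t) * s turns the sum over [s] into the Leibniz formula; the k!
   choices of [t] cancel the normalisation of the wedge product. *)
have H (t : 'S_k) : \sum_(s : 'S_(1 + k)) (-1) ^+ s *
     a ord0 p (fun i => v (s (lshift k i))) *
     ((-1) ^+ t * \prod_(i < k) a (lift ord0 i) p (fun=> v (s (rshift 1 (t i)))))
    = \det (\matrix_(i, j) a i p (fun=> v j)).
  rewrite [RHS](reindex_inj (mulgI (lift_perm ord0 ord0 t))) /=.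
  apply: eq_bigr => s _.
  rewrite big_ord_recl odd_permM odd_lift_perm /= signr_addb.
  rewrite !mxE permM lift_perm_id.
  have -> : (fun i : 'I_1 => v (s (lshift k i))) = (fun=> v (s ord0)).
    by apply/funext => x; congr (v (s _)); apply: val_inj; rewrite /= ord1.
  rewrite [X in _ = X * _]mulrC [RHS]mulrACA; congr (_ * (_ * _)).
  apply: eq_bigr => i _; rewrite mxE permM lift_perm_lift.
  by have -> : rshift 1 (t i) = lift ord0 (t i) :> 'I_(1 + k) by exact: val_inj.
rewrite -[(1`!)%N]/1%N mul1r.
under eq_bigr do rewrite IH mulr_sumr.
rewrite exchange_big /=.
under eq_bigr => t _.
  under eq_bigr => s _ do under [X in _ * (_ * X)]eq_bigr do rewrite mxE.
  rewrite H; over.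
by rewrite sumr_const card_Sn -[X in _ * X = _]mulr_natl mulrA mulVf ?mul1r//.
Qed.

Definition volx n : Defs.form R n n := fun p v => voldet p.2 (fun i => (v i).1).
Definition voly n : Defs.form R n n := fun p v => voldet p.2 (fun i => (v i).2).

Lemma sum_dxE n (p : ambient R n) v :
  \sum_(i < n.+1) (-1) ^+ i * p.2 ord0 i *
    bigwedge (fun j : 'I_n => @dx R n (lift i j)) p v = volx p v.
Proof.
by rewrite /volx voldet_expand; apply: eq_bigr => i _; rewrite bigwedgeE.
Qed.

Lemma sum_dyE n (p : ambient R n) v :
  \sum_(i < n.+1) (-1) ^+ i * p.2 ord0 i *
    bigwedge (fun j : 'I_n => @dy R n (lift i j)) p v = voly p v.
Proof.
by rewrite /voly voldet_expand; apply: eq_bigr => i _; rewrite bigwedgeE.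
Qed.

Lemma voldet_linear n (y : 'rV[R]_n.+1) w i a u v :
  voldet y (dfwith w i (a *: u + v)) =
  a * voldet y (dfwith w i u) + voldet y (dfwith w i v).
Proof.
(* [determinant_multilinear] expects a coefficient in front of both terms. *)
rewrite -[X in _ = _ + X]mul1r.
have out x j k : k != i ->
    (col_mx y (\matrix_j dfwith w i x j) : 'M[R]_(1 + n)) (lift ord0 k) j = w k ord0 j.
  by move=> ki; rewrite col_mx_rowS dfwithout// eq_sym.
have same x z : row' (lift ord0 i) (col_mx y (\matrix_j dfwith w i x j) : 'M[R]_(1 + n))
   = row' (lift ord0 i) (col_mx y (\matrix_j dfwith w i z j) : 'M[R]_(1 + n)).
  apply/matrixP => k j; rewrite [LHS]mxE [RHS]mxE.
  have := neq_lift (lift ord0 i : 'I_n.+1) k.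
  case: (unliftP ord0 (lift (lift ord0 i) k)) => [k' ->|->].
    by move=> h; rewrite !out//; apply: contraNneq h => ->.
  by rewrite !col_mx_row0.
have rowi x :
    row (lift ord0 i) (col_mx y (\matrix_j dfwith w i x j) : 'M[R]_(1 + n)) = x.
  by apply/rowP => j; rewrite mxE col_mx_rowS dfwithin.
apply: (@determinant_multilinear _ _ _ _ _ (lift ord0 i)); [|exact: same..].
by rewrite !rowi scale1r.
Qed.

Lemma voldet_alternate n (y : 'rV[R]_n.+1) w i j :
  i != j -> w i = w j -> voldet y w = 0.
Proof.
move=> ij wij; apply: (@determinant_alternate _ _ _ (lift ord0 i) (lift ord0 j)).
  by rewrite (inj_eq lift_inj).
by move=> k; rewrite !col_mx_rowS wij.
Qed.

Lemma voldet_eq0 n (y : 'rV[R]_n.+1) w i : w i = 0 -> voldet y w = 0.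
Proof.
move=> w0; rewrite /voldet (expand_det_row _ (lift ord0 i)) big1// => j _.
by rewrite col_mx_rowS w0 mxE mul0r.
Qed.

End Algebra.

(** * Tangent vectors *)

Section Calculus.
Context (R : realType).

Lemma Ck_cst (V W : normedModType R) k (U : set V) (a : W) :
  Ck k U (fun=> a).
Proof.
elim: k a => [|k IH] a /=; first by move=> p _; exact: cst_continuous.
split=> [p _|v]; first exact: differentiable_cst.
have -> : (fun p : V => 'D_v (fun=> a) p) = (fun=> 0) :> (V -> W).
  by apply/funext => p; exact: derive_cst.
exact: IH.
Qed.

Lemma linear_derive (V W : normedModType R) (f : V -> W) (p v : V) :
  linear f -> continuous f -> differentiable f p /\ 'D_v f p = f v.
Proof.
move=> lf cf.
pose fL : {linear V -> W} := HB.pack f (GRing.isLinear.Build R V W *:%R f lf).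
have df : differentiable (fL : V -> W) p by exact: linear_differentiable.
by split=> //; rewrite deriveE// (@diff_lin _ _ _ fL).
Qed.

(** The directional derivatives are constant. The forms and frames below depend linearly on the base
    point, so this is their source of smoothness. *)
Lemma smooth_linear (V W : normedModType R) (U : set V) (f : V -> W) :
  linear f -> continuous f -> smooth_on U f.
Proof.
move=> lf cf [|k] /=; first by move=> p _; exact: cf.
split=> [p _|v]; first exact: (linear_derive p 0 lf cf).1.
have -> : (fun p : V => 'D_v f p) = (fun=> f v) :> (V -> W).
  by apply/funext => p; exact: (linear_derive p v lf cf).2.
exact: Ck_cst.
Qed.

Lemma diff_linear_comp (U V W : normedModType R) (f : V -> W) (h : U -> V) q w :
  linear f -> continuous f -> differentiable h q ->
  'd (f \o h) q w = f ('d h q w).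
Proof.
move=> lf cf dh; have [df _] := linear_derive (h q) 0 lf cf.
by rewrite diff_comp//= -deriveE//; exact: (linear_derive _ _ lf cf).2.
Qed.

Lemma is_derive_diff_comp (V W : normedModType R) (f : V -> W)
    (gamma : R -> V) (t : R) v :
  differentiable f (gamma t) -> is_derive t 1 gamma v ->
  is_derive t 1 (f \o gamma) ('d f (gamma t) v).
Proof.
move=> df [/derivable1_diffP dg <-].
have dfg : differentiable (f \o gamma) t by exact: differentiable_comp.
split; first exact/derivable1_diffP.
by rewrite !deriveE// diff_comp.
Qed.

Lemma is_derive_linear_comp (V W : normedModType R) (f : V -> W)
    (gamma : R -> V) (t : R) v :
  linear f -> continuous f -> is_derive t 1 gamma v ->
  is_derive t 1 (f \o gamma) (f v).
Proof.
move=> lf cf dg; have [df <-] := linear_derive (gamma t) v lf cf.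
by rewrite deriveE//; exact: is_derive_diff_comp.
Qed.

Lemma is_derive_scalel (V : normedModType R) (k : R -> R) (dk t : R) (f : V) :
  is_derive t 1 k dk -> is_derive t 1 (fun x => k x *: f) (dk *: f).
Proof.
move=> hk; apply: (@is_derive_linear_comp R^o V (fun r => r *: f) k) => //.
- by move=> a u v; rewrite scalerDl scalerA.
- exact: scalel_continuous.
Qed.

Lemma coord_linear m (i : 'I_m) : linear (fun u : 'rV[R]_m => u ord0 i : R^o).
Proof. by move=> a u v; rewrite !mxE. Qed.

Lemma coord_cts m (i : 'I_m) : continuous (fun u : 'rV[R]_m => u ord0 i : R^o).
Proof. by case: m i => [[]//|m] i; exact: coord_continuous. Qed.

Lemma fst_linear (V W : normedModType R) : linear (@fst V W).
Proof. by []. Qed.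

Lemma snd_linear (V W : normedModType R) : linear (@snd V W).
Proof. by []. Qed.

Lemma fst_cts (V W : normedModType R) : continuous (@fst V W).
Proof. by move=> p; exact: cvg_fst. Qed.

Lemma snd_cts (V W : normedModType R) : continuous (@snd V W).
Proof. by move=> p; exact: cvg_snd. Qed.

Lemma snd_coord_linear n (i : 'I_n.+1) :
  linear (fun p : ambient R n => p.2 ord0 i : R^o).
Proof. by move=> a u v; rewrite !mxE. Qed.

Lemma snd_coord_cts n (i : 'I_n.+1) :
  continuous (fun p : ambient R n => p.2 ord0 i : R^o).
Proof.
move=> p; apply: (@continuous_comp _ _ _ snd (fun u : 'rV[R]_n.+1 => u ord0 i)).
  exact: snd_cts.
exact: coord_continuous.
Qed.

Lemma snd_dot_linear n (a : 'rV[R]_n.+1) :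
  linear (fun p : ambient R n => dot p.2 a : R^o).
Proof. by move=> b u v; rewrite /= dot_linearl. Qed.

Lemma snd_dot_cts n (a : 'rV[R]_n.+1) :
  continuous (fun p : ambient R n => dot p.2 a : R^o).
Proof.
move=> p; apply: cvg_big => [|i _]; first exact: add_continuous.
apply: cvgM; [exact: snd_coord_cts|exact: cvg_cst].
Qed.

Lemma is_derive_dot n (gamma : R -> 'rV[R]_n) (t : R) (v : 'rV[R]_n) :
  is_derive t 1 gamma v ->
  is_derive t 1 (fun x => dot (gamma x) (gamma x)) (2 * dot v (gamma t)).
Proof.
move=> dg.
have dc i : is_derive t 1 (fun x => gamma x ord0 i) (v ord0 i).
  exact: (is_derive_linear_comp (@coord_linear n i) (@coord_cts n i)).
have : is_derive t 1 (\sum_i (fun x => gamma x ord0 i) * (fun x => gamma x ord0 i))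
  (\sum_i (gamma t ord0 i * v ord0 i + gamma t ord0 i * v ord0 i)).
  by apply: is_derive_sum => i; exact: is_deriveM.
rewrite fct_sumE.
suff -> : \sum_i (gamma t ord0 i * v ord0 i + gamma t ord0 i * v ord0 i) =
  2 * dot v (gamma t) by [].
rewrite /dot mulr_sumr; apply: eq_bigr => i _ /=.
by rewrite [v _ _ * _]mulrC mulr_natl.
Qed.

Lemma is_derive_one_sub_sqr (s : R) :
  is_derive (0 : R) 1 (cst 1 - s *: (id ^+ 2)) 0.
Proof.
by apply: is_derive_eq; rewrite expr1 !(mul0r, mulr0, scaler0, addr0, scale0r, subr0).
Qed.

Lemma is_derive_circle_den (s : R) :
  is_derive (0 : R) 1 (fun t : R => (1 + s * t ^+ 2)^-1) 0.
Proof.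
pose d : R -> R := cst 1 - (- s) *: (id ^+ 2).
have dE : d = fun t => 1 + s * t ^+ 2.
  by apply/funext => t; rewrite /d /= scaleNr opprK.
have [dd d'] : is_derive (0 : R) 1 d 0 := is_derive_one_sub_sqr (- s).
have d0 : d 0 != 0 by rewrite dE/= expr0n mulr0 addr0 oner_eq0.
rewrite -[fun t => _]/(fun t => ((fun t => 1 + s * t ^+ 2) t)^-1) -dE.
by split; [exact: derivableV|rewrite deriveV// d' scaler0].
Qed.

Lemma is_derive_circle_sin (s : R) :
  is_derive (0 : R) 1 (fun t : R => t / (1 + s * t ^+ 2)) 1.
Proof.
have h := is_deriveM (is_derive_id (0 : R) 1) (is_derive_circle_den s).
apply: (@is_derive_eq _ _ _ _ _ _ _ _ h).
by rewrite expr0n mulr0 addr0 invr1 scaler0 add0r scale1r.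
Qed.

Lemma is_derive_circle_cos (s : R) :
  is_derive (0 : R) 1 (fun t : R => (1 - s * t ^+ 2) / (1 + s * t ^+ 2)) 0.
Proof.
have h := is_deriveM (is_derive_one_sub_sqr s) (is_derive_circle_den s).
apply: (@is_derive_eq _ _ _ _ _ _ _ _ h).
by rewrite !scaler0 addr0.
Qed.

(* The rational (stereographic) parametrisation of the great circle through [y]
   with velocity [v], when [v] is orthogonal to the unit vector [y]. *)
Definition circle n (y v : 'rV[R]_n) (t : R) : 'rV[R]_n :=
  let s := dot v v / 4 in
  ((1 - s * t ^+ 2) / (1 + s * t ^+ 2)) *: y + (t / (1 + s * t ^+ 2)) *: v.

Lemma circle_den_gt0 n (v : 'rV[R]_n) t : 0 < 1 + dot v v / 4 * t ^+ 2.
Proof.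
by rewrite ltr_pwDl// mulr_ge0 ?sqr_ge0// divr_ge0// dotxx_ge0.
Qed.

(** With s = |v|^2 / 4, this is the identity (1 - s t^2)^2 + 4 s t^2 = (1 + s t^2)^2. *)
Lemma circle_sphere n (y v : 'rV[R]_n.+1) t : sphere y -> dot v y = 0 ->
  sphere (circle y v t).
Proof.
rewrite /sphere /= => y1 vy; rewrite /circle /=.
have := circle_den_gt0 v t.
rewrite !(dotDl, dotDr, dotZl, dotZr) (dotC y) vy y1.
move: (dot v v) => a /gt_eqF/negbT d0; field.
(* [field] asks for 4 + a t^2 to be nonzero, which is four times the denominator of [circle]. *)
apply: contraNneq d0 => h.
by rewrite (_ : _ + _ = (4 + a * t ^+ 2) / 4); [rewrite h mul0r|field].
Qed.

Lemma circle_tangent n (y v : 'rV[R]_n) :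
  is_derive (0 : R) 1 (circle y v) v.
Proof.
rewrite -[X in is_derive _ _ _ X]add0r -(scale0r y) -{2}[v]scale1r.
by apply: is_deriveD; apply: is_derive_scalel;
  [exact: is_derive_circle_cos|exact: is_derive_circle_sin].
Qed.

Lemma circle0 n (y v : 'rV[R]_n) : circle y v 0 = y.
Proof.
by rewrite /circle /= expr0n/= mulr0 subr0 addr0 divr1 mul0r scale1r scale0r addr0.
Qed.

(** The function <gamma, gamma> is constant near 0, while its derivative there is 2 <v, gamma 0>. *)
Lemma is_derive_sphere n (gamma : R -> 'rV[R]_n.+1) v :
  (\forall t \near (0 : R), sphere (gamma t)) -> is_derive (0 : R) 1 gamma v ->
  dot v (gamma 0) = 0.
Proof.
move=> gS dg; have h := is_derive_dot dg.
have : is_derive (0 : R) 1 (fun x => dot (gamma x) (gamma x)) 0.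
  have e : \forall x \near (0 : R), cst (1 : R) x = dot (gamma x) (gamma x).
    by apply: filterS gS => x /= ->.
  by apply: (near_eq_is_derive e); exact: is_derive_cst.
move=> [_]; case: h => _ -> /eqP.
by rewrite mulf_eq0 pnatr_eq0/= => /eqP.
Qed.

Lemma tangent_sphere n (y v : 'rV[R]_n.+1) : sphere y ->
  tangent (@sphere R n) y v <-> dot v y = 0.
Proof.
move=> y1; split=> [[gamma [<- gS dg]]|vy]; first exact: is_derive_sphere.
exists (circle y v); split; [exact: circle0| |exact: circle_tangent].
by apply: (@filterE _ (nbhs (0 : R))) => t; exact: circle_sphere.
Qed.

(** For the converse, the first component runs along a straight line and the second along a great
    circle. *)
Lemma tangent_unit_tangent_bundle n (p v : ambient R n) :
  unit_tangent_bundle p ->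
  tangent (@unit_tangent_bundle R n) p v <-> dot v.2 p.2 = 0.
Proof.
move=> p1; split=> [[gamma [<- gS dg]]|vp].
  apply: (@is_derive_sphere _ (snd \o gamma)); first exact: gS.
  exact: (is_derive_linear_comp (@snd_linear _ _) (@snd_cts _ _)).
exists (fun t => (p.1 + t *: v.1, circle p.2 v.2 t)); split.
- by rewrite circle0 scale0r addr0 -surjective_pairing.
- by apply: (@filterE _ (nbhs (0 : R))) => t; exact: circle_sphere.
pose inr u : ambient R n := (0, u).
pose w : ambient R n := (v.1, 0).
(* The curve is split into a constant, a linear term and the image of the great circle under the
   inclusion of the second factor, which are differentiated separately. *)
have -> : (fun t => (p.1 + t *: v.1, circle p.2 v.2 t)) =
    (cst ((p.1, 0) : ambient R n) + (fun t => t *: w)) + (inr \o circle p.2 v.2)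
    :> (R -> ambient R n).
  apply/funext => t; rewrite /= !fctE /cst /=.
  by congr (_, _); rewrite /= ?addr0// scaler0 !add0r.
rewrite [X in is_derive _ _ _ X](_ : v = (0 + 1 *: w) + inr v.2); last first.
  by rewrite add0r scale1r; case: (v) @w => a b w; congr (_, _); rewrite /= ?addr0 ?add0r.
have hw := @is_derive_scalel (ambient R n) id 1 0 w (is_derive_id _ _).
have h1 := is_deriveD (is_derive_cst ((p.1, 0) : ambient R n) (0 : R) 1) hw.
suff h2 : is_derive (0 : R) 1 (inr \o circle p.2 v.2) (inr v.2) by exact: (is_deriveD h1 h2).
apply: (@is_derive_linear_comp _ _ inr (circle p.2 v.2)); last exact: circle_tangent.
- by move=> a x y; congr (_, _); rewrite /= ?scaler0 ?addr0.
- move=> x; apply: (@cvg_pair _ _ _ (nbhs x) (nbhs (0 : 'rV[R]_n.+1)) (nbhs x)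
    _ _ _ (cst 0) id); [exact: cvg_cst|exact: cvg_id].
Qed.

End Calculus.

(** * The contact structure *)

Section Contact.
Context (R : realType) (n : nat).
Notation M := (@unit_tangent_bundle R n).
Notation theta := (@theta_std R n).

Lemma theta_stdE (p : ambient R n) v : theta p v = dot p.2 (v ord0).1.
Proof. by []. Qed.

(** On a fixed vector [theta] is linear in the base point, so its derivative along w is obtained by
    putting w.2 in place of y. *)
Lemma extd_theta_std (p u v : ambient R n) :
  extd theta p (tnth [tuple u; v]) = dot u.2 v.1 - dot v.2 u.1.
Proof.
rewrite /extd big_ord_recl big_ord1 expr0 expr1 mul1r mulN1r.
have E w a : 'D_w (fun q : ambient R n => dot q.2 a : R) p = dot w.2 a.
  exact: (linear_derive p w (@snd_dot_linear R n a) (@snd_dot_cts R n a)).2.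
by congr (_ - _); rewrite -E; congr ('D_ _ _ _); apply/funext => q;
  rewrite theta_stdE.
Qed.

Lemma snd_dot_snd_derive (q w : ambient R n) :
  differentiable (fun q : ambient R n => dot q.2 q.2 : R) q /\
  'd (fun q : ambient R n => dot q.2 q.2 : R) q w = 2 * dot q.2 w.2.
Proof.
pose c (i : 'I_n.+1) (q : ambient R n) : R := q.2 ord0 i.
have dc i : differentiable (c i) q /\ 'D_w (c i) q = w.2 ord0 i.
  exact: (linear_derive q w (@snd_coord_linear R n i) (@snd_coord_cts R n i)).
have -> : (fun q : ambient R n => dot q.2 q.2 : R) = \sum_i (c i * c i).
  by apply/funext => x; rewrite fct_sumE.
have dd : differentiable (\sum_i (c i * c i)) q.
  by apply: differentiable_sum => i; apply: differentiableM; exact: (dc i).1.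
split=> //; rewrite -deriveE// derive_sum; last first.
  by move=> i; apply: derivableM; apply: diff_derivable; exact: (dc i).1.
rewrite mulr_sumr; apply: eq_bigr => i _.
rewrite deriveM; [|by apply: diff_derivable; exact: (dc i).1..].
by rewrite (dc i).2 mulr_natl.
Qed.

(** Scaling [const_mx 1] makes the scalar equation |y|^2 = 1 a map into row vectors, as
    [submanifold] requires. *)
Definition sphere_eq (q : ambient R n) : 'rV[R]_1 :=
  (dot q.2 q.2 - 1) *: const_mx 1.

Lemma sphere_eq_derive (q w : ambient R n) :
  differentiable sphere_eq q /\
  'd sphere_eq q w = (2 * dot q.2 w.2) *: const_mx 1.
Proof.
have [df fE] := snd_dot_snd_derive q w.
pose f : ambient R n -> R := fun q => dot q.2 q.2.
have d1 := differentiable_cst (1 : R) q.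
have dg : differentiable (f - cst 1) q by exact: differentiableB.
have -> : sphere_eq = fun q => (f - cst 1) q *: const_mx 1 by [].
split; first exact: differentiableZl.
rewrite diffZl// (diffB df d1) diff_cst -fE.
by congr (_ *: _); exact: subr0.
Qed.

(** The map is quadratic: after one differentiation it is linear in the base point and
    [smooth_linear] applies. *)
Lemma smooth_sphere_eq (U : set (ambient R n)) : smooth_on U sphere_eq.
Proof.
move=> [|k] /=.
  by move=> q _; apply: differentiable_continuous; exact: (sphere_eq_derive q 0).1.
split=> [q _|v]; first exact: (sphere_eq_derive q 0).1.
have -> : (fun q => 'D_v sphere_eq q) = (fun q => (2 * dot q.2 v.2) *: const_mx 1).
  apply/funext => q; rewrite deriveE; last exact: (sphere_eq_derive q 0).1.
  exact: (sphere_eq_derive q v).2.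
apply: smooth_linear => [a x y|x].
  by rewrite dotDl dotZl mulrDr scalerDl scalerA mulrCA.
apply: cvgZl; apply: cvgM; [exact: cvg_cst|exact: snd_dot_cts].
Qed.

Lemma unit_tangent_bundle_submanifold : submanifold n.*2.+1 M.
Proof.
move=> p p1; exists setT, 1, sphere_eq; split.
- by split; [exact: openT|].
(* One equation in a space of dimension 2(n + 1) leaves dimension 2n + 1. *)
- by rewrite dimvf /dim /= !dim_matrix; lia.
- exact: smooth_sphere_eq.
- move=> q _; rewrite /unit_tangent_bundle /sphere /sphere_eq /=; split => [->|].
    by rewrite subrr scale0r.
  move=> /rowP/(_ ord0); rewrite !mxE mulr1 => /eqP.
  by rewrite subr_eq0 => /eqP.
- move=> q _; rewrite /unit_tangent_bundle /sphere /= => q1 w.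
  (* The radial vector a y has derivative 2 a |y|^2 = 2 a, whence the factor 1/2. *)
  exists (0, (w ord0 ord0 / 2) *: q.2); rewrite (sphere_eq_derive _ _).2 /= dotZr q1.
  by apply/rowP => i; rewrite !ord1 !mxE !mulr1; field.
Qed.

Lemma is_form_theta_std : is_form setT theta.
Proof.
split.
- move=> p _ v i a u w; rewrite !theta_stdE !ord1 !dfwithin.
  by rewrite /= dotDr dotZr.
- by move=> p _ v i j; rewrite !ord1 eqxx.
- move=> v; apply: smooth_linear.
    exact: snd_dot_linear.
  exact: snd_dot_cts.
Qed.

Lemma kernel_dist_theta_std (p v : ambient R n) : M p ->
  kernel_dist M theta p v <-> dot v.1 p.2 = 0 /\ dot v.2 p.2 = 0.
Proof.
move=> p1; rewrite /kernel_dist /= theta_stdE /= dotC.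
have [h1 h2] := tangent_unit_tangent_bundle v p1.
by split => -[? ?]; split=> //; [exact: h1|exact: h2].
Qed.

Lemma contact_unit_tangent_bundle : contact_manifold M theta.
Proof.
split; [exact: unit_tangent_bundle_submanifold|exact: is_form_theta_std|].
move=> p p1; split.
  (* Moving x along its normal y gives [theta] the value |y|^2 = 1. *)
  exists (p.2, 0); first by apply/tangent_unit_tangent_bundle => //=; rewrite dot0l.
  rewrite theta_stdE /=; have -> : dot p.2 p.2 = 1 by [].
  exact: oner_neq0.
move=> u /(kernel_dist_theta_std u p1)[u1 u2] h.
(* This is the complex structure of D applied to u: pairing it with u under d theta gives |u.1|^2 +
   |u.2|^2, which vanishes only for u = 0. *)
have /h : kernel_dist M theta p (u.2, - u.1).
  by apply/kernel_dist_theta_std => //=; rewrite dotNl u1 oppr0.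
rewrite extd_theta_std /= dotNl opprK => /eqP; rewrite paddr_eq0 ?dotxx_ge0//.
move=> /andP[/eqP/dotxx_eq0 u20 /eqP/dotxx_eq0 u10].
by apply: injective_projections.
Qed.

Lemma isotropic_E1_std : isotropic M theta (@E1_std R n).
Proof.
by move=> p p1 u v [_ u2] [_ v2]; rewrite extd_theta_std u2 v2 !dot0l subrr.
Qed.

Lemma isotropic_E2_std : isotropic M theta (@E2_std R n).
Proof.
by move=> p p1 u v [u1 _] [v1 _]; rewrite extd_theta_std u1 v1 !dot0r subrr.
Qed.

Lemma E2_stdE (p v : ambient R n) : M p ->
  E2_std p v <-> v.1 = 0 /\ dot v.2 p.2 = 0.
Proof.
by move=> p1; split => -[v1 /tangent_sphere h]; split=> //; apply/h.
Qed.

Lemma kernel_dist_decomposition (p : ambient R n) : M p ->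
  kernel_dist M theta p =
    [set v | exists u1 u2, [/\ E1_std p u1, E2_std p u2 & v = u1 + u2]] /\
  @E1_std R n p `&` @E2_std R n p = [set 0].
Proof.
move=> p1; split; apply/seteqP; split => v /=.
- move=> /kernel_dist_theta_std -/(_ p1)[v1 v2].
  exists (v.1, 0), (0, v.2); split.
  + by split.
  + exact/E2_stdE.
  + by apply: injective_projections; rewrite /= ?addr0 ?add0r.
- move=> [u1 [u2 [[h1 h2] /E2_stdE -/(_ p1)[h3 h4] ->]]].
  apply/kernel_dist_theta_std => //=.
  by rewrite h3 h2 addr0 add0r.
- by move=> [[_ v2] [v1 _]]; apply: injective_projections.
- by move=> ->; split; [split; rewrite //= dot0l|apply/E2_stdE; rewrite //= dot0l].
Qed.

End Contact.

(** * Frames and the Lagrangian pair *)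

Section Frames.
Context (R : realType) (n : nat).
Notation M := (@unit_tangent_bundle R n).

(* Being polynomial in [y], this is a smooth frame of the orthogonal of [y]
   wherever the [k]-th coordinate of [y] does not vanish. *)
Definition perp_frame (k : 'I_n.+1) (y : 'rV[R]_n.+1) (j : 'I_n) : 'rV[R]_n.+1 :=
  y ord0 k *: delta_mx ord0 (lift k j) - y ord0 (lift k j) *: delta_mx ord0 k.

Lemma dot_delta (i : 'I_n.+1) (y : 'rV[R]_n.+1) : dot (delta_mx ord0 i) y = y ord0 i.
Proof.
rewrite /dot (bigD1 i)//= big1 => [|j /negbTE ji]; rewrite !mxE ?eqxx ?ji ?mul0r//.
by rewrite mul1r addr0.
Qed.

Lemma perp_frame_perp k (y : 'rV[R]_n.+1) j : dot (perp_frame k y j) y = 0.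
Proof. by rewrite dotDl dotNl !dotZl !dot_delta mulrC subrr. Qed.

Lemma perp_frame_lift k (y : 'rV[R]_n.+1) j i :
  perp_frame k y j ord0 (lift k i) = y ord0 k * (i == j)%:R.
Proof.
rewrite !mxE !eqxx/= (inj_eq lift_inj) eq_sym.
by rewrite [_ == k]eq_sym (negbTE (neq_lift _ _)) mulr0 subr0 eq_sym.
Qed.

Lemma sum_perp_frame_lift k (y : 'rV[R]_n.+1) (a : 'I_n -> R) i :
  (\sum_j a j *: perp_frame k y j) ord0 (lift k i) = a i * y ord0 k.
Proof.
rewrite summxE (bigD1 i)//= big1 => [|j /negbTE ji].
  by rewrite addr0 mxE perp_frame_lift eqxx mulr1.
by rewrite mxE perp_frame_lift eq_sym ji !mulr0.
Qed.

Lemma dot_suml (I : finType) (F : I -> 'rV[R]_n.+1) (y : 'rV[R]_n.+1) :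
  dot (\sum_i F i) y = \sum_i dot (F i) y.
Proof.
by elim/big_ind2: _ => [|? ? ? ? <- <-|//]; rewrite ?dot0l ?dotDl.
Qed.

(** The coefficients are chosen to match every coordinate except the [k]-th. That one is then forced
    by orthogonality to [y], whose [k]-th coordinate is nonzero. *)
Lemma perp_frame_span k (y v : 'rV[R]_n.+1) : y ord0 k != 0 -> dot v y = 0 ->
  v = \sum_j (v ord0 (lift k j) / y ord0 k) *: perp_frame k y j.
Proof.
move=> yk vy; set w := \sum_j _.
have wy : dot w y = 0.
  by rewrite dot_suml big1// => j _; rewrite dotZl perp_frame_perp mulr0.
have e j : w ord0 (lift k j) = v ord0 (lift k j).
  by rewrite sum_perp_frame_lift divfK.
apply/rowP => i; have [j ->|->] := unliftP k i; first exact/esym.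
apply: (mulIf yk).
have := etrans vy (esym wy); rewrite /dot !(bigD1_ord k)//=.
by under [X in _ = _ + X]eq_bigr do rewrite e; exact: addIr.
Qed.

Lemma exists_coord_neq0 (y : 'rV[R]_n.+1) : sphere y -> exists k, y ord0 k != 0.
Proof.
move=> y1; apply/existsP; apply: contraT; rewrite negb_exists => /forallP y0.
have := oner_neq0 R; rewrite -[1]y1 (_ : y = 0) ?dot0l ?eqxx//.
by apply/rowP => i; rewrite mxE; apply/eqP; have := y0 i; rewrite negbK.
Qed.

(** In a vanishing combination of the rows, the inner product with [y] kills the coefficient of [y];
    freeness of [w] then kills the others. *)
Lemma voldet_neq0 (y : 'rV[R]_n.+1) (w : 'I_n -> 'rV[R]_n.+1) :
  sphere y -> (forall i, dot (w i) y = 0) ->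
  (forall a : 'I_n -> R, \sum_i a i *: w i = 0 -> forall i, a i = 0) ->
  voldet y w != 0.
Proof.
move=> y1 wy wfree; rewrite /voldet -unitfE -unitmxE -row_free_unit.
apply: inj_row_free => v.
rewrite -[v]hsubmxK mul_row_col [X in X *m y]mx11_scalar mul_scalar_mx.
set a := lsubmx v ord0 ord0; rewrite mulmx_sum_row.
under eq_bigr do rewrite rowK.
set b := rsubmx v; move=> h.
have a0 : a = 0.
  have := congr1 (fun u => dot u y) h; rewrite dotDl dotZl dot0l dot_suml big1.
    by have -> : dot y y = 1 by []; rewrite mulr1 addr0.
  by move=> j _; rewrite dotZl wy mulr0.
move: h; rewrite a0 scale0r add0r => /wfree h.
have b0 : b = 0 by apply/rowP => i; rewrite h mxE.
rewrite b0 (_ : lsubmx v = 0) ?row_mx0//.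
by apply/matrixP => i j; rewrite !ord1 [RHS]mxE -a0.
Qed.

Lemma voldet_perp_frame k (y : 'rV[R]_n.+1) : sphere y -> y ord0 k != 0 ->
  voldet y (perp_frame k y) != 0.
Proof.
move=> y1 yk; apply: voldet_neq0 => // [i|a h i]; first exact: perp_frame_perp.
have := congr1 (fun u : 'rV_n.+1 => u ord0 (lift k i)) h.
by rewrite sum_perp_frame_lift mxE => /eqP; rewrite mulf_eq0 (negbTE yk) orbF => /eqP.
Qed.

(** Treats E_1 and E_2 together: each is the hyperplane orthogonal to y, placed by [iota] in one of
    the two factors. *)
Lemma subbundle_perp (iota : 'rV[R]_n.+1 -> ambient R n)
    (E : ambient R n -> set (ambient R n)) :
  linear iota -> continuous iota -> injective iota ->
  (forall p, M p -> forall v, E p v <-> exists2 u, dot u p.2 = 0 & v = iota u) ->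
  subbundle n M E.
Proof.
move=> li ci ii EE p p1; have [k yk] := exists_coord_neq0 p1.
pose iL : {linear _ -> _} := HB.pack iota (GRing.isLinear.Build R _ _ *:%R iota li).
(* On this open set the vectors [perp_frame k] form a basis of the hyperplane, and they depend
   linearly on q. *)
exists [set q : ambient R n | q.2 ord0 k != 0],
  (fun j (q : ambient R n) => iota (perp_frame k q.2 j)); split.
- split=> //; apply: (@open_comp _ _ (fun q : ambient R n => q.2 ord0 k : R) [set x : R | x != 0]).
    by move=> x _; exact: snd_coord_cts.
  exact: open_neq.
- move=> i; apply: smooth_linear => [a x y|x].
    rewrite -li; congr iota; rewrite /perp_frame !mxE.
    by rewrite !scalerDl scalerBr !scalerA opprD addrACA.
  apply: (@continuous_comp _ _ _ (fun q : ambient R n => perp_frame k q.2 i)); last exact: ci.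
  by apply: cvgB; apply: cvgZl; exact: snd_coord_cts.
move=> q q1 qk; have X (j : 'I_n) :
    [tuple iota (perp_frame k q.2 i) | i < n]`_j = iota (perp_frame k q.2 j).
  by rewrite -tnth_nth tnth_mktuple.
have lin (a : 'I_n -> R) : \sum_i a i *: [tuple iota (perp_frame k q.2 i) | i < n]`_i
    = iota (\sum_i a i *: perp_frame k q.2 i).
  rewrite -[iota]/(iL : _ -> _) linear_sum; apply: eq_bigr => j _.
  by rewrite X linearZ.
split.
  apply/freeP => a; rewrite lin => h0 j.
  have /ii h : iota (\sum_i a i *: perp_frame k q.2 i) = iota 0.
    by rewrite h0 -[iota]/(iL : _ -> _) linear0.
  have := congr1 (fun u : 'rV_n.+1 => u ord0 (lift k j)) h.
  rewrite sum_perp_frame_lift mxE => /eqP.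
  by rewrite mulf_eq0 (negbTE qk) orbF => /eqP.
apply/seteqP; split => v.
  move=> /(EE _ q1)[u uq ->] /=; rewrite (perp_frame_span qk uq) -lin.
  apply: rpred_sum => j _; apply: rpredZ; apply: memv_span.
  by rewrite mem_nth ?size_tuple.
move=> /coord_span vE; apply/(EE _ q1).
exists (\sum_i coord [tuple iota (perp_frame k q.2 i) | i < n] i v *: perp_frame k q.2 i);
  last by rewrite -lin.
by rewrite dot_suml big1// => j _; rewrite dotZl perp_frame_perp mulr0.
Qed.

End Frames.

(** * The Monge-Ampère system *)

Section MongeAmpere.
Context (R : realType) (n : nat).
Notation M := (@unit_tangent_bundle R n).
Notation theta := (@theta_std R n).

Lemma lagrangian_pair_std : lagrangian_pair M theta (@E1_std R n) (@E2_std R n).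
Proof.
split; [split|split|exact: kernel_dist_decomposition].
- apply: (@subbundle_perp _ _ (fun u => (u, 0) : ambient R n)).
  + by move=> a x y; congr (_, _); rewrite /= scaler0 addr0.
  + move=> x; apply: (@cvg_pair _ _ _ (nbhs x) (nbhs x) (nbhs (0 : 'rV[R]_n.+1)) _ _ _ id (cst 0)).
      exact: cvg_id.
    exact: cvg_cst.
  + by move=> x y [].
  + move=> p p1 v; split=> [[v1 v2]|[u up ->]]; last by split.
    by exists v.1 => //; apply: injective_projections.
- apply: (@subbundle_perp _ _ (fun u => (0, u) : ambient R n)).
  + by move=> a x y; congr (_, _); rewrite /= scaler0 addr0.
  + move=> x; apply: (@cvg_pair _ _ _ (nbhs x) (nbhs (0 : 'rV[R]_n.+1)) (nbhs x) _ _ _ (cst 0) id).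
      exact: cvg_cst.
    exact: cvg_id.
  + by move=> x y [].
  + move=> p p1 v; split=> [/E2_stdE -/(_ p1)[v1 v2]|[u up ->]].
      by exists v.2 => //; apply: injective_projections.
    exact/E2_stdE.
- exact: isotropic_E1_std.
- exact: isotropic_E2_std.
Qed.

Lemma is_form_voldet (U : set (ambient R n)) (a : R)
    (pr : {linear ambient R n -> 'rV[R]_n.+1}) :
  is_form U (fun p (v : 'I_n -> ambient R n) => a * voldet p.2 (fun i => pr (v i))).
Proof.
have prE (v : 'I_n -> ambient R n) i x :
    (fun j => pr (dfwith v i x j)) = dfwith (fun j => pr (v j)) i (pr x).
  apply/funext => j; have [<-|ij] := eqVneq i j; first by rewrite !dfwithin.
  by rewrite !dfwithout.
split.
- by move=> p _ v i b u w; rewrite !prE linearP voldet_linear mulrDr mulrCA.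
- move=> p _ v i j ij vij; rewrite (@voldet_alternate _ _ _ _ i j)// ?mulr0//.
  by rewrite vij.
(* With [v] fixed, the expansion along the first row makes the form the inner product of y with the
   vector [w] of cofactors, hence linear in the base point. *)
- move=> v; pose w := \row_i (a * ((-1) ^+ i *
    \det (\matrix_(j, k) (pr (v k) : 'rV[R]_n.+1) ord0 (lift i j)))).
  have -> : (fun p : ambient R n => a * voldet p.2 (fun i => pr (v i)) : R) =
            (fun p => dot p.2 w).
    apply/funext => p; rewrite voldet_expand mulr_sumr; apply: eq_bigr => i _.
    by rewrite mxE; ring.
  by apply: smooth_linear; [exact: snd_dot_linear|exact: snd_dot_cts].
Qed.

Lemma is_form_volx (U : set (ambient R n)) a : is_form U (fun p v => a * volx p v : R).
Proof. exact: (@is_form_voldet U a fst). Qed.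

Lemma is_form_voly (U : set (ambient R n)) : is_form U (@voly R n).
Proof.
have -> : @voly R n = fun p v => 1 * voldet p.2 (fun i => (v i).2).
  by apply/funext => p; apply/funext => v; rewrite mul1r.
exact: (@is_form_voldet U 1 snd).
Qed.

(** Since the neighbourhood can be taken to be the whole space, this gives both the closure of the
    system as an ideal and its local description by generators. *)
Lemma ideal_idem (N U : set (ambient R n)) (G : forall k, set (Defs.form R n k)) k
    (eta : Defs.form R n k) :
  ideal N U (@ideal R n N U G) eta <-> ideal N U G eta.
Proof.
split; last exact: ideal_gen.
elim=> {k eta}.
- by [].
- by move=> k; exact: ideal_zero.
- by move=> k e1 e2 _ h1 _ h2; exact: ideal_add.
- by move=> k l e1 e2 h1 _ h2; exact: ideal_wedgel.
- by move=> k l e1 e2 h1 _ h2; exact: ideal_wedger.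
- by move=> k e1 e2 h1 h2 _ h3; exact: ideal_eq h3.
Qed.

Lemma omega_stdE (c : R) (p : ambient R n) v :
  omega_std c p v = c * volx p v - voly p v.
Proof. by rewrite /omega_std sum_dxE sum_dyE. Qed.

Lemma monge_ampere_system_std (c : R) : c != 0 ->
  monge_ampere_system M theta (@E1_std R n) (@E2_std R n)
    (@ideal R n M setT (@generators R n n theta (@omega_std R n c))).
Proof.
move=> c0; split.
- exact: contact_unit_tangent_bundle.
- exact: lagrangian_pair_std.
- by move=> k eta /ideal_idem.
(* The decomposition of omega is global. The constant c goes into the first term, which is a volume
   form on E_1 because c is nonzero. *)
move=> p p1; exists setT, (fun p v => c * volx p v), (@voly R n); split.
- by split; [exact: openT|].
- by split; [exact: is_form_volx|exact: is_form_voly].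
- split=> q q1 _ v _ j.
    by move=> /(E2_stdE _ q1)[v1 _]; rewrite /volx (voldet_eq0 _ v1) mulr0.
  by move=> [_ v2]; rewrite /voly (voldet_eq0 _ v2).
(* Both forms are tested on the same frame of the hyperplane orthogonal to y, placed in the first
   factor and then in the second. *)
- split=> q q1 _; have [k qk] := exists_coord_neq0 q1;
    have qn := voldet_perp_frame q1 qk.
    exists (fun j => (perp_frame k q.2 j, 0)); last by rewrite mulf_neq0.
    by move=> j; split=> //=; exact: perp_frame_perp.
  exists (fun j => (0, perp_frame k q.2 j)) => // j.
  by apply/E2_stdE => //; split=> //=; exact: perp_frame_perp.
move=> k eta; have -> : (fun q v => c * volx q v - voly q v) = @omega_std R n c.
  by apply/funext => q; apply/funext => v; rewrite omega_stdE.
exact: ideal_idem.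
Qed.

End MongeAmpere.

(** * Gaussian curvature *)

Section Curvature.
Context (R : realType).

(** The change of vectors is left multiplication by the block matrix diag(1, B). *)
Lemma voldet_mul n (y : 'rV[R]_n.+1) (w : 'I_n -> 'rV[R]_n.+1) (B : 'M[R]_n) :
  voldet y (fun i => \sum_j B i j *: w j) = \det B * voldet y w.
Proof.
rewrite /voldet.
have -> : \matrix_i (\sum_j B i j *: w j) = B *m \matrix_j w j.
  by apply/row_matrixP => i; rewrite rowK row_mul mulmx_sum_row;
    apply: eq_bigr => j _; rewrite rowK mxE.
have -> : col_mx y (B *m \matrix_j w j) = block_mx 1%:M 0 0 B *m col_mx y (\matrix_j w j).
  by rewrite mul_block_col mul1mx !mul0mx addr0 add0r.
by rewrite det_mulmx det_ublock det1 mul1r.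
Qed.

(* [\dim {:subvs_of (perp y)}] equals [n] only propositionally, whence the
   families indexed by [nat]. *)
Lemma voldet_mul_cast n d (y : 'rV[R]_n.+1) (B : 'M[R]_d) (u w : nat -> 'rV[R]_n.+1) :
  d = n -> (forall i : 'I_d, u i = \sum_j B i j *: w j) ->
  voldet y (fun i => u i) = \det B * voldet y (fun i => w i).
Proof.
move=> dn; move: dn B => -> B uE; rewrite -voldet_mul; congr voldet.
by apply/funext => i.
Qed.

(** Row i of [mxof e e G] holds the coordinates of G e_i, so [voldet_mul_cast] applies. It is used
    with [vT] the hyperplane orthogonal to [y] and [f] its inclusion. *)
Lemma voldet_lfun n (vT : vectType R) (e : (\dim {:vT}).-tuple vT) (G : 'End(vT))
    (f : {linear vT -> 'rV[R]_n.+1}) (y : 'rV[R]_n.+1) : \dim {:vT} = n ->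
  basis_of fullv e ->
  voldet y (fun i => f (G e`_i)) =
  \det (passmx.mxof e e G) * voldet y (fun i => f e`_i).
Proof.
move=> dn be.
apply: (@voldet_mul_cast _ _ _ _ (fun i => f (G e`_i)) (fun i => f e`_i) dn) => i.
rewrite -[e`_i](passmx.vecof_delta e) (passmx.hom_vecof e be) -rowE linear_sum.
by apply: eq_bigr => j _; rewrite linearZ mxE.
Qed.

Lemma mem_perp n (y v : 'rV[R]_n.+1) : (v \in perp y) = (dot v y == 0).
Proof.
have ld : linear (fun xi : 'rV[R]_n.+1 => dot xi y : R^o).
  by move=> a u w; rewrite dot_linearl.
pose dL : {linear _ -> _} := HB.pack (fun xi : 'rV[R]_n.+1 => dot xi y : R^o)
  (GRing.isLinear.Build R _ _ *:%R _ ld).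
by rewrite /perp memv_ker -[linfun _]/(linfun dL) lfunE.
Qed.

Lemma dim_rV m : \dim {:'rV[R]_m} = m.
Proof. by rewrite dimvf dim_matrix; exact: mul1n. Qed.

(** Rank-nullity: the image lies in the line R, and it is nonzero because [y] is not orthogonal to
    itself. *)
Lemma dim_perp n (y : 'rV[R]_n.+1) : sphere y -> \dim (perp y) = n.
Proof.
move=> y1.
have := limg_ker_dim (linfun (fun xi : 'rV[R]_n.+1 => dot xi y : R^o)) fullv.
rewrite capfv -/(perp y) dim_rV.
set l := limg _ => h.
have l1 : (\dim l <= 1)%N.
  by apply: leq_trans (dimvS (subvf l)) _; rewrite dimvf.
have lN0 : (0 < \dim l)%N.
  rewrite lt0n; apply/eqP => l0; have /eqP Pf : perp y == fullv.
    rewrite eqEdim subvf /=; move: h; rewrite l0 addn0 => ->.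
    by rewrite dim_rV.
  have : y \in perp y by rewrite Pf memvf.
  rewrite mem_perp; have -> : dot y y = 1 by [].
  by rewrite oner_eq0.
have l2 : \dim l = 1%N by apply/eqP; rewrite eqn_leq l1.
by move: h; rewrite l2 addn1 => -[].
Qed.

(** Pull a basis e of the hyperplane back through A to vectors w_i, so that A w_i = e_i and B w_i =
    G e_i. The volume of the B w_i is then both det G and c times that of the e_i, which is
    nonzero. *)
Lemma gauss_map_det n (y : 'rV[R]_n.+1) (A B : 'Hom('rV[R]_n, 'rV[R]_n.+1)) (c : R) :
  sphere y -> injective A ->
  (forall w, dot (A w) y = 0) -> (forall w, dot (B w) y = 0) ->
  (forall w, voldet y (fun i => B (w i)) = c * voldet y (fun i => A (w i))) ->
  lfun_det (linfun (vsproj (perp y)) \o B \o A^-1 \o linfun vsval)%VF = c.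
Proof.
move=> y1 Ai Ay By ABc; set G := (_ \o linfun vsval)%VF.
(* Inclusion together with equality of dimensions, A being injective on a space of dimension n. *)
have limgA : limg A = perp y.
  apply/eqP; rewrite eqEdim; apply/andP; split.
    by apply/subvP => _ /memv_imgP[w _ ->]; rewrite mem_perp Ay.
  rewrite dim_perp// limg_dim_eq; first by rewrite dim_rV.
  by rewrite (eqP (introT lker0P Ai)) capv0.
have dP : \dim {:subvs_of (perp y)} = n by rewrite dimvf; exact: dim_perp.
pose e := vbasis {:subvs_of (perp y)}.
have be : basis_of fullv e := vbasisP _.
pose w (i : nat) := (A^-1)%VF (vsval e`_i).
have Aw i : A (w i) = vsval e`_i by rewrite limg_lfunVK// limgA subvsP.
have Bw i : vsval (G e`_i) = B (w i).
  rewrite !lfunE /= !lfunE /= !lfunE /= lfunE /= vsprojK//.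
  by rewrite mem_perp By.
have E : voldet y (fun i : 'I_n => B (w i)) =
         lfun_det G * voldet y (fun i : 'I_n => A (w i)).
  rewrite -[lfun_det G]/(\det (passmx.mxof e e G)).
  have -> : (fun i : 'I_n => B (w i)) = (fun i => vsval (G e`_i)).
    by apply/funext => i; rewrite Bw.
  have -> : (fun i : 'I_n => A (w i)) = (fun i => vsval e`_i).
    by apply/funext => i; rewrite Aw.
  exact: (@voldet_lfun n _ e G vsval).
move: E; rewrite ABc => /esym; apply: mulIf.
apply: voldet_neq0 => // a h i.
have /freeP efree := basis_free be.
(* Indices are transported along [dP] to use the freeness of [e], whose length is the dimension of
   the hyperplane. *)
pose i' := cast_ord (esym dP) i.
rewrite -[i](cast_ordKV dP) -/i'.
apply: (efree (fun j => a (cast_ord dP j))) => {i i'}.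
apply: val_inj; rewrite /= -[RHS]h linear_sum /=.
rewrite [RHS](reindex (cast_ord dP)) /=; last first.
  by exists (cast_ord (esym dP)) => j _; rewrite ?cast_ordK ?cast_ordKV.
by apply: eq_bigr => j _; rewrite Aw.
Qed.

Section Solution.
Context (n : nat) (c : R) (L : manifold R n) (g : L -> ambient R n).
Context (gsol : geometric_solution (@unit_tangent_bundle R n) (@theta_std R n)
  (@omega_std R n c) g).
Context (p : L) (phi : chart R n L).
Context (phip : chart_at p phi).

Let chart_mapK : chart_inv phi (chart_map phi p) = p.
Proof. by have [/atlas_charts[_ _ h _ _] pd] := phip; exact: h. Qed.

Let g_differentiable : differentiable (g \o chart_inv phi) (chart_map phi p).
Proof.
have [_ gs _ _ _] := gsol; have [pa pd] := phip.
by have [+ _] := gs phi pa 1%N; apply; exists p.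
Qed.

Lemma mdiff_proj_x w : mdiff (@proj_x R n \o g) p phi w = (mdiff g p phi w).1.
Proof.
exact: (diff_linear_comp w (@fst_linear _ _ _) (@fst_cts _ _ _) g_differentiable).
Qed.

Lemma mdiff_proj_y w : mdiff (@proj_y R n \o g) p phi w = (mdiff g p phi w).2.
Proof.
exact: (diff_linear_comp w (@snd_linear _ _ _) (@snd_cts _ _ _) g_differentiable).
Qed.

Lemma mdiff_proj_x_perp w : dot (mdiff (@proj_x R n \o g) p phi w) (g p).2 = 0.
Proof.
have [_ _ _ + _] := gsol => /(_ p phi phip (fun=> w)).
by rewrite theta_stdE dotC mdiff_proj_x.
Qed.

(** The image under g of a line in the chart has its y-component on the sphere, so its velocity is
    orthogonal to y. *)
Lemma mdiff_proj_y_perp w : dot (mdiff (@proj_y R n \o g) p phi w) (g p).2 = 0.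
Proof.
have [gM _ _ _ _] := gsol.
pose line (t : R) := chart_map phi p + t *: w.
have line0 : line 0 = chart_map phi p by rewrite /line scale0r addr0.
have dl : is_derive (0 : R) 1 line w.
  rewrite -[w in X in is_derive _ _ _ X]scale1r -[1 *: w]add0r.
  by apply: is_deriveD; exact: is_derive_scalel.
have := g_differentiable; rewrite -line0 => gd.
have dg := is_derive_diff_comp gd dl.
have ds := is_derive_linear_comp (@snd_linear _ _ _) (@snd_cts _ _ _) dg.
have := is_derive_sphere _ ds.
rewrite mdiff_proj_y /mdiff /= line0 chart_mapK; apply.
(* [chart_inv phi] is a total function into L, so this holds for every t, even where the line leaves
   the image of the chart. *)
by apply: (@filterE _ (nbhs (0 : R))) => t; exact: gM.
Qed.

(** This is the vanishing of the pullback of omega, in the form that [gauss_map_det] takes as its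
    volume hypothesis. *)
Lemma gauss_map_voldet (w : 'I_n -> 'rV[R]_n) :
  voldet (g p).2 (fun i => mdiff (@proj_y R n \o g) p phi (w i)) =
  c * voldet (g p).2 (fun i => mdiff (@proj_x R n \o g) p phi (w i)).
Proof.
have [_ _ _ _ /(_ p phi phip w)] := gsol; rewrite omega_stdE /volx /voly.
move=> /eqP; rewrite subr_eq0 => /eqP /esym.
under [X in voldet _ X]eq_fun do rewrite -mdiff_proj_y.
under [X in c * voldet _ X]eq_fun do rewrite -mdiff_proj_x.
by [].
Qed.

Lemma gaussian_curvature_const : ~ singular_locus g p ->
  lfun_det (gauss_map_diff (@proj_x R n \o g) (@proj_y R n \o g) p phi) = c.
Proof.
move=> /contrapT /(_ phi phip) finj; have [gM _ _ _ _] := gsol.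
pose A := linfun (mdiff (@proj_x R n \o g) p phi).
pose B := linfun (mdiff (@proj_y R n \o g) p phi).
have AE w : A w = mdiff (@proj_x R n \o g) p phi w by rewrite lfunE.
have BE w : B w = mdiff (@proj_y R n \o g) p phi w by rewrite lfunE.
apply: gauss_map_det.
- exact: gM.
- by move=> u v; rewrite !AE => /finj.
- by move=> w; rewrite AE; exact: mdiff_proj_x_perp.
- by move=> w; rewrite BE; exact: mdiff_proj_y_perp.
move=> w.
have EA : (fun i => A (w i)) = (fun i => mdiff (@proj_x R n \o g) p phi (w i)).
  by apply/funext => i; exact: AE.
have EB : (fun i => B (w i)) = (fun i => mdiff (@proj_y R n \o g) p phi (w i)).
  by apply/funext => i; exact: BE.
apply: (etrans (congr1 (voldet _) EB)); apply: (etrans (gauss_map_voldet w)).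
exact: (congr1 (fun u => c * voldet _ u) (esym EA)).
Qed.

End Solution.
End Curvature.

Theorem proposition8p5 (R : realType) (n : nat) (c : R) (hc : c != 0) :
  monge_ampere_system (@unit_tangent_bundle R n) (@theta_std R n)
    (@E1_std R n) (@E2_std R n)
    (@ideal R n (@unit_tangent_bundle R n) setT
       (@generators R n n (@theta_std R n) (@omega_std R n c))) /\
  forall (L : manifold R n) (g : L -> ambient R n),
    geometric_solution (@unit_tangent_bundle R n) (@theta_std R n)
      (@omega_std R n c) g ->
    forall p : L, ~ singular_locus g p ->
      has_gaussian_curvature (@proj_x R n \o g) (@proj_y R n \o g) p c.
Proof.
split; first exact: monge_ampere_system_std.
move=> L g gsol p psing phi phip; split.
- by move: psing => /contrapT /(_ phi phip).
- by have [gM _ _ _ _] := gsol; exact: gM.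
- exact: mdiff_proj_x_perp gsol _ _ phip.
- exact: gaussian_curvature_const gsol _ _ phip psing.
Qed.
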